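(* Fix $\eta\in(0,1)$. Under the EXP algorithm with parameter $\eta$, for all integers $T>0$, $$\mathbb{E}[\phi(\overline{\mu}[T])]\;\ge\;\phi^{opt}-\frac{\phi^{opt}-\phi(0)}{\eta T}-\frac{\eta G\|\mu^{max}\|^2}{2}.$$
   Context: System model: $n$ users, slotted time $t\in\{0,1,2,\ldots\}$. Channel state vectors $\{S[t]\}_{t\ge0}$ are i.i.d. over slots, taking values in a set $\mathcal{S}\subseteq\mathbb{R}^m$, with a distribution unknown to the controller. Let $\mathcal{B}=[0,\mu_1^{max}]\times\cdots\times[0,\mu_n^{max}]$ with $\mu_i^{max}>0$, and $\mu^{max}=(\mu_1^{max},\ldots,\mu_n^{max})$. For each $s\in\mathcal{S}$, $\Gamma_s$ is a nonempty closed bounded (possibly nonconvex) subset of $\mathcal{B}$. Each slot the controller observes $S[t]$ and chooses $\mu[t]\in\Gamma_{S[t]}$ (decisions may depend on current and past observations and on randomization). Define $\overline{\mu}[T]=\frac1T\sum_{t=0}^{T-1}\mu[t]$. Utility: $\phi:\mathcal{B}\to\mathbb{R}$ is concave, entrywise nondecreasing, differentiable, and $G$-smooth: $\|\phi'(x)-\phi'(y)\|\le G\|x-y\|$ for all $x,y\in\mathcal{B}$ (Euclidean norm; gradients on the boundary of $\mathcal{B}$ are defined as limits from the interior and satisfy the same Lipschitz bound). Capacity region: $\Gamma^*\subseteq\mathbb{R}^n$ is the set of all expectations $\mathbb{E}[\mu[0]]$ achievable by choosing $\mu[0]\in\Gamma_{S[0]}$ according to any (possibly randomized) conditional rule given $S[0]$;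 $\Gamma^*$ is convex and its closure $\overline{\Gamma}^*$ is convex and compact. $\phi^{opt}$ denotes the optimal value of maximizing $\liminf_{T\to\infty}\phi(\mathbb{E}[\overline{\mu}[T]])$ over all such policies; it is a standing fact that $\phi^{opt}=\max_{x\in\overline{\Gamma}^*}\phi(x)$. Weighted averaging algorithm: given stepsizes $0<\eta_t\le1$, set $\gamma[-1]=0\in\mathbb{R}^n$; on each slot $t\ge0$, observe $\gamma[t-1]$ and $S[t]$, choose $\mu[t]$ as a maximizer of $\phi'(\gamma[t-1])^{\top}\mu$ over $\mu\in\Gamma_{S[t]}$ (ties broken arbitrarily but measurably), and set $\gamma[t]=(1-\eta_t)\gamma[t-1]+\eta_t\mu[t]$. The EXP algorithm with parameter $\eta\in(0,1)$ is this algorithm with $\eta_t=\eta$ for all $t$. *)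

(* Defs.v *)
From HB Require Import structures.
From mathcomp Require Import all_boot all_order all_algebra.
From mathcomp Require Import all_classical all_reals all_analysis.
Set Implicit Arguments. Unset Strict Implicit. Unset Printing Implicit Defensive.
Import Order.TTheory GRing.Theory Num.Theory.
Local Open Scope classical_set_scope.
Local Open Scope ring_scope.

Section Euclid.
Context {R : realType} {n : nat}.

Definition dotv (x y : 'rV[R]_n) : R := \sum_(i < n) x ord0 i * y ord0 i.

Definition enorm (x : 'rV[R]_n) : R := Num.sqrt (\sum_(i < n) x ord0 i ^+ 2).

Definition ratebox (mumax : 'rV[R]_n) : set 'rV[R]_n :=
  [set x | forall i, 0 <= x ord0 i <= mumax ord0 i].

Definition eclosure_set (A : set 'rV[R]_n) : set 'rV[R]_n :=
  [set x | forall e : R, 0 < e -> exists2 y, A y & enorm (x - y) < e].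

Definition eclosed_set (A : set 'rV[R]_n) : Prop := eclosure_set A `<=` A.

Definition concave_in (B : set 'rV[R]_n) (phi : 'rV[R]_n -> R) : Prop :=
  forall x y (l : R), B x -> B y -> 0 <= l <= 1 ->
    l * phi x + (1 - l) * phi y <= phi (l *: x + (1 - l) *: y).

Definition nondecr_in (B : set 'rV[R]_n) (phi : 'rV[R]_n -> R) : Prop :=
  forall x y, B x -> B y -> (forall i, x ord0 i <= y ord0 i) -> phi x <= phi y.

(* phi is (Frechet) differentiable on B, relative to B, with gradient grad x
   at every x in B (at interior points this is ordinary differentiability;
   at boundary points grad x is the limit of interior gradients) *)
Definition gradient_in (B : set 'rV[R]_n) (phi : 'rV[R]_n -> R)
    (grad : 'rV[R]_n -> 'rV[R]_n) : Prop :=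
  forall x, B x -> forall e : R, 0 < e -> exists2 dl : R, 0 < dl &
    forall y, B y -> enorm (y - x) < dl ->
      `|phi y - phi x - dotv (grad x) (y - x)| <= e * enorm (y - x).

Definition lipschitz_in (B : set 'rV[R]_n) (f : 'rV[R]_n -> 'rV[R]_n) (G : R) :=
  forall x y, B x -> B y -> enorm (f x - f y) <= G * enorm (x - y).

End Euclid.

Section Model.
Context {R : realType} {n : nat}.
Context {d : measure_display} {Omega : measurableType d} (P : probability Omega R).
Context {dT : measure_display} {T : measurableType dT}.

Definition indep_events (F H : set (set Omega)) : Prop :=
  forall A B, F A -> H B -> P (A `&` B) = (P A * P B)%E.

Definition rv_events (X : Omega -> T) : set (set Omega) :=
  [set A | exists2 B, measurable B & A = X @^-1` B].

Definition vrv_events (Y : Omega -> 'rV[R]_n) : set (set Omega) :=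
  [set A | exists i, exists2 B : set R, measurable B &
                     A = (fun w => Y w ord0 i) @^-1` B].

Definition iid_states (S : nat -> Omega -> T) : Prop :=
  [/\ (forall t, measurable_fun setT (S t)),
      (forall t (B : set T), measurable B -> P (S t @^-1` B) = P (S 0 @^-1` B)) &
      (forall (I : seq nat) (B : nat -> set T), uniq I ->
         (forall k, measurable (B k)) ->
         P (\bigcap_(k in [set` I]) (S k @^-1` B k)) =
           (\prod_(k <- I) fine (P (S k @^-1` B k)))%:E)].

(* causality: decisions up to slot t (which may use S[0..t] and
   randomization) are independent of the future states S[t+1], S[t+2], ... *)
Definition past_events (S : nat -> Omega -> T) (mu : nat -> Omega -> 'rV[R]_n)
    (t : nat) : set (set Omega) :=
  [set A | exists2 k, (k <= t)%N & rv_events (S k) A \/ vrv_events (mu k) A].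

Definition future_events (S : nat -> Omega -> T) (t : nat) : set (set Omega) :=
  [set A | exists2 k, (t < k)%N & rv_events (S k) A].

Definition nonanticipating (S : nat -> Omega -> T) (mu : nat -> Omega -> 'rV[R]_n) :=
  forall t, indep_events <<s past_events S mu t >> <<s future_events S t >>.

Definition admissible_policy (S : nat -> Omega -> T) (Gam : T -> set 'rV[R]_n)
    (mu : nat -> Omega -> 'rV[R]_n) : Prop :=
  [/\ forall t i, measurable_fun setT (fun w => mu t w ord0 i),
      forall t w, Gam (S t w) (mu t w) &
      nonanticipating S mu].

(* Capacity region Gamma^*: expectations E[mu[0]] where mu[0] = f(S[0], U)
   with U an independent randomization (on an arbitrary probability space
   (U,Q)), f jointly measurable, f(s,u) in Gamma_s. *)
Definition Gamma_star (S0 : Omega -> T) (Gam : T -> set 'rV[R]_n) : set 'rV[R]_n :=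
  [set x | exists (dU : measure_display) (U : measurableType dU)
             (Q : probability U R) (f : T -> U -> 'rV[R]_n),
     [/\ forall i, measurable_fun setT (fun p : T * U => f p.1 p.2 ord0 i),
         forall s u, Gam s (f s u) &
         forall i, (\int[(P \x Q)%E]_p (f (S0 p.1) p.2 ord0 i)%:E)%E = (x ord0 i)%:E]].

Definition phiopt (S0 : Omega -> T) (Gam : T -> set 'rV[R]_n)
    (phi : 'rV[R]_n -> R) : R :=
  sup [set phi x | x in eclosure_set (Gamma_star S0 Gam)].

(* gprev eta mu t w = gamma[t-1] of the weighted-averaging recursion
   with constant stepsize eta, gamma[-1] = 0 *)
Fixpoint gprev (eta : R) (mu : nat -> Omega -> 'rV[R]_n) (t : nat) (w : Omega)
    : 'rV[R]_n :=
  match t with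
  | 0 => 0
  | t'.+1 => (1 - eta) *: gprev eta mu t' w + eta *: mu t' w
  end.

Definition EXP_decisions (eta : R) (grad : 'rV[R]_n -> 'rV[R]_n)
    (S : nat -> Omega -> T) (Gam : T -> set 'rV[R]_n)
    (mu : nat -> Omega -> 'rV[R]_n) : Prop :=
  forall t w y, Gam (S t w) y ->
    dotv (grad (gprev eta mu t w)) y <= dotv (grad (gprev eta mu t w)) (mu t w).

Definition mubar (mu : nat -> Omega -> 'rV[R]_n) (Tn : nat) (w : Omega) : 'rV[R]_n :=
  (Tn%:R)^-1 *: \sum_(t < Tn) mu t w.

End Model.

(* Main.v *)
Require Import Defs.
From HB Require Import structures.
From mathcomp Require Import all_boot all_order all_algebra.
From mathcomp Require Import all_classical all_reals all_analysis.
From mathcomp Require Import measurable_realfun ring lra.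
Import Order.TTheory GRing.Theory Num.Theory.
Import numFieldNormedType.Exports.
Local Open Scope classical_set_scope.
Local Open Scope ring_scope.

(* Smoothness and the concavity of [phi] turn one step of the recursion into
     [phi gam_t >= phi gam_(t-1) + eta * grad (gam_(t-1)) . (mu_t - gam_(t-1)) - eta^2 G |mumax|^2 / 2].
   As [mu_t] maximizes [grad (gam_(t-1)) . y] over [y] in [Gam (S t)], and [S t] is independent of
   [gam_(t-1)], in expectation [mu_t] may be replaced by any [x] in the capacity region; concavity
   then gives, with [c = eta G |mumax|^2 / 2] and [a_t = E phi gam_(t-1)],
     [a_(t+1) >= (1 - eta) a_t + eta (phiopt - c)],
   hence [a_t >= phiopt - c - (phiopt - phi 0) (1 - eta)^t]. Summing the recursion shows that [mubar]
   dominates the average of the [gam_(t-1)] entrywise, so monotonicity and Jensen's inequality bound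
   [E phi mubar] below by the average of the [a_t]. Solving the recursion for [a_t], rather than
   telescoping it, avoids having to compare [E phi gam] with [phiopt]. *)

(** * Euclidean inner product and norm on row vectors *)

Section Euclidean.
Context {R : realType} {n : nat}.
Implicit Types x y z : 'rV[R]_n.

Lemma dotvC x y : dotv x y = dotv y x.
Proof. by apply: eq_bigr => i _; rewrite mulrC. Qed.

Lemma dotvDr x y z : dotv x (y + z) = dotv x y + dotv x z.
Proof. by rewrite -big_split; apply: eq_bigr => i _; rewrite mxE mulrDr. Qed.

Lemma dotvZr k x y : dotv x (k *: y) = k * dotv x y.
Proof. by rewrite mulr_sumr; apply: eq_bigr => i _; rewrite mxE mulrCA. Qed.

Lemma dotvNr x y : dotv x (- y) = - dotv x y.
Proof. by rewrite -scaleN1r dotvZr mulN1r. Qed.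

Lemma dotvBr x y z : dotv x (y - z) = dotv x y - dotv x z.
Proof. by rewrite dotvDr dotvNr. Qed.

Lemma dotvBl x y z : dotv (x - y) z = dotv x z - dotv y z.
Proof. by rewrite dotvC dotvBr !(dotvC z). Qed.

Lemma dotvv_ge0 x : 0 <= dotv x x.
Proof. by apply: sumr_ge0 => i _; rewrite -expr2 sqr_ge0. Qed.

Lemma enormE x : enorm x = Num.sqrt (dotv x x).
Proof. by congr Num.sqrt; apply: eq_bigr => i _; rewrite expr2. Qed.

Lemma enorm_ge0 x : 0 <= enorm x.
Proof. exact: sqrtr_ge0. Qed.

Lemma sqr_enorm x : enorm x ^+ 2 = dotv x x.
Proof. by rewrite enormE sqr_sqrtr ?dotvv_ge0. Qed.

Lemma enormZ k x : enorm (k *: x) = `|k| * enorm x.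
Proof.
rewrite !enormE dotvZr (dotvC (k *: x)) dotvZr mulrA -expr2 sqrtrM ?sqr_ge0//.
by rewrite sqrtr_sqr.
Qed.

Lemma enormN x : enorm (- x) = enorm x.
Proof. by rewrite -scaleN1r enormZ normrN1 mul1r. Qed.

Lemma enorm_distC x y : enorm (x - y) = enorm (y - x).
Proof. by rewrite -enormN opprB. Qed.

Lemma normr_coord_le_enorm x i : `|x ord0 i| <= enorm x.
Proof.
have sq0 (Q : pred 'I_n) : 0 <= \sum_(j < n | Q j) x ord0 j ^+ 2.
  by apply: sumr_ge0 => j _; exact: sqr_ge0.
by rewrite -sqrtr_sqr /enorm ler_sqrt// [leRHS](bigD1 i)//= lerDl.
Qed.

(** Cauchy-Schwarz: the squared norm of [|y| x - |x| y] is nonnegative and equals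
    [2 |x| |y| (|x| |y| - x.y)]. *)
Lemma dotv_le_enorm x y : dotv x y <= enorm x * enorm y.
Proof.
have [x0|xn0] := eqVneq (enorm x) 0.
  rewrite x0 mul0r /dotv big1// => i _.
  have := normr_coord_le_enorm x i; rewrite x0 normr_le0 => /eqP ->.
  by rewrite mul0r.
have [y0|yn0] := eqVneq (enorm y) 0.
  rewrite y0 mulr0 /dotv big1// => i _.
  have := normr_coord_le_enorm y i; rewrite y0 normr_le0 => /eqP ->.
  by rewrite mulr0.
have xy0 : 0 < enorm x * enorm y by rewrite mulr_gt0// lt0r ?xn0 ?yn0 enorm_ge0.
have := dotvv_ge0 (enorm y *: x - enorm x *: y).
rewrite dotvBr !dotvBl !dotvZr 4!(dotvC (_ *: _)) !dotvZr -!sqr_enorm (dotvC y x).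
set a := enorm x in xy0 *; set b := enorm y in xy0 *; set p := dotv x y.
have -> : b * (b * a ^+ 2) - b * (a * p) - (a * (b * p) - a * (a * b ^+ 2))
   = (a * b) * (a * b - p) * 2 by ring.
by rewrite pmulr_lge0// pmulr_rge0// subr_ge0.
Qed.

Lemma normr_dotv_le x y : `|dotv x y| <= enorm x * enorm y.
Proof.
rewrite ler_norml lerNl dotv_le_enorm andbT -dotvNr.
by rewrite (le_trans (dotv_le_enorm _ _))// enormN.
Qed.

(** The crude factor [n] suffices: the bound only serves to make a rounding error tend to 0. *)
Lemma enorm_le_coord x (c : R) : (forall i, `|x ord0 i| <= c) -> 0 <= c ->
  enorm x <= n%:R * c.
Proof.
move=> xc c0; rewrite -[leRHS]ger0_norm ?mulr_ge0// -sqrtr_sqr ler_sqrt ?sqr_ge0//.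
have : \sum_(i < n) x ord0 i ^+ 2 <= \sum_(i < n) c ^+ 2.
  by apply: ler_sum => i _; rewrite -[leLHS]real_normK ?num_real// lerXn2r ?nnegrE.
rewrite sumr_const card_ord => /le_trans; apply.
rewrite -[_ *+ n]mulr_natl [leRHS]exprMn ler_wpM2r ?sqr_ge0// expr2.
case: (n) => [|k]; first by rewrite mul0r.
by rewrite ler_peMl// ler1n.
Qed.

(** Relative to [A] and in the Euclidean norm, because the assumptions control [phi] and [grad] only
    on the box and in that norm. *)
Definition econtinuous_in (A : set 'rV[R]_n) (h : 'rV[R]_n -> R) :=
  forall x, A x -> forall e : R, 0 < e -> exists2 dl : R, 0 < dl &
    forall y, A y -> enorm (y - x) < dl -> `|h y - h x| < e.

(** * Concave smooth functions on the rate box *)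

Section Box.
Variable b : 'rV[R]_n.
Hypothesis b_gt0 : forall i, 0 < b ord0 i.
Local Notation B := (ratebox b).

Lemma ratebox_conv l x y : 0 <= l <= 1 -> B x -> B y -> B (l *: x + (1 - l) *: y).
Proof.
move=> /andP[l0 l1] Bx By i; rewrite !mxE.
have /andP[x0 x1] := Bx i; have /andP[y0 y1] := By i.
by apply/andP; split; nra.
Qed.

Lemma ratebox0 : B 0.
Proof. by move=> i; rewrite mxE lexx/= ltW. Qed.

Lemma rateboxb : B b.
Proof. by move=> i; rewrite lexx ltW. Qed.

Lemma ratebox_diam x y : B x -> B y -> enorm (x - y) <= enorm b.
Proof.
move=> Bx By; rewrite ler_sqrt; last by apply: sumr_ge0 => i _; exact: sqr_ge0.
apply: ler_sum => i _; rewrite !mxE.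
have /andP[x0 x1] := Bx i; have /andP[y0 y1] := By i.
by nra.
Qed.

Lemma eclosed_ratebox : eclosed_set B.
Proof.
move=> x clx i; apply/andP; split; apply/ler_addgt0Pr => e e0.
  have [y /(_ i)/andP[y0 _] xye] := clx _ e0.
  have := le_lt_trans (normr_coord_le_enorm _ i) xye; rewrite !mxE ltr_norml.
  by move=> /andP[? ?]; lra.
have [y /(_ i)/andP[_ y1] xye] := clx _ e0.
have := le_lt_trans (normr_coord_le_enorm _ i) xye; rewrite !mxE ltr_norml.
by move=> /andP[? ?]; lra.
Qed.

Lemma ratebox_mean (g : nat -> 'rV[R]_n) N : (forall t, B (g t)) -> (0 < N)%N ->
  B (N%:R^-1 *: \sum_(t < N) g t).
Proof.
move=> gB N0 i; have N' : 0 < N%:R :> R by rewrite ltr0n.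
rewrite mxE summxE; apply/andP; split.
  by rewrite mulr_ge0// sumr_ge0// => t _; case/andP: (gB t i).
rewrite mulrC ler_pdivrMr// mulr_natr -[X in _ *+ X]card_ord -sumr_const.
by apply: ler_sum => t _; case/andP: (gB t i).
Qed.

Variables (phi : 'rV[R]_n -> R) (grad : 'rV[R]_n -> 'rV[R]_n) (G : R).
Hypothesis phi_concave : concave_in B phi.
Hypothesis phi_nondecr : nondecr_in B phi.
Hypothesis phi_grad : gradient_in B phi grad.
Hypothesis grad_lip : lipschitz_in B grad G.

(** Differentiability with tolerance 1 gives [|phi y - phi x| <= (|grad x| + 1) |y - x|] near
    [x]. *)
Lemma econtinuous_gradient : econtinuous_in B phi.
Proof.
move=> x Bx e e0; have [dl dl0 dlP] := phi_grad _ Bx _ ltr01.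
have g0 := enorm_ge0 (grad x).
have K0 : 0 < enorm (grad x) + 1 by lra.
exists (Num.min dl (e / (enorm (grad x) + 1))); first by rewrite lt_min dl0 divr_gt0.
move=> y By; rewrite lt_min => /andP[/(dlP _ By) H]; rewrite ltr_pdivlMr// => lte.
apply: le_lt_trans lte.
have := normr_dotv_le (grad x) (y - x).
have := ler_normD (phi y - phi x - dotv (grad x) (y - x)) (dotv (grad x) (y - x)).
rewrite subrK; lra.
Qed.

Lemma econtinuous_lipschitz_coord i : econtinuous_in B (fun x => grad x ord0 i).
Proof.
move=> x Bx e e0.
(* This denominator is positive whatever the sign of [G]. *)
exists (e / (`|G| + 1)); first by rewrite divr_gt0// ltr_wpDl.
move=> y By; rewrite ltr_pdivlMr ?ltr_wpDl// => lte; apply: le_lt_trans lte.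
have := normr_coord_le_enorm (grad y - grad x) i; rewrite !mxE.
have := grad_lip _ _ By Bx; have := enorm_ge0 (y - x); have := ler_norm G.
by nra.
Qed.

(** With [z = x + l (y - x)], concavity gives [l (phi y - phi x) <= phi z - phi x], and
    differentiability at [x] bounds the right side by [l D + l e]; divide by [l]. *)
Lemma concave_gradient x y : B x -> B y -> phi y <= phi x + dotv (grad x) (y - x).
Proof.
move=> Bx By; set N := enorm (y - x).
have N0 : 0 <= N := enorm_ge0 _.
apply/ler_addgt0Pr => e e0.
have N1 : 0 < N + 1 by lra.
have [dl dl0 dlP] := phi_grad _ Bx _ (divr_gt0 e0 N1).
have dlN : 0 < dl + N by lra.
(* This [l] lies in []0, 1]] even when [N = 0], and [l N < dl] puts [z] within the radius of
   differentiability. *)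
pose l := dl / (dl + N).
have l0 : 0 < l by rewrite divr_gt0.
have l1 : l <= 1 by rewrite ler_pdivrMr//; lra.
have l01 : 0 <= l <= 1 by rewrite l1 ltW.
pose z := l *: y + (1 - l) *: x.
have zx : z - x = l *: (y - x).
  by rewrite /z scalerBl scale1r scalerBr addrCA addrAC subrr add0r.
have Bz : B z by exact: ratebox_conv.
have := dlP _ Bz; rewrite zx enormZ gtr0_norm// -/N => /(_ _)/wrap[].
  by rewrite /l mulrAC ltr_pdivrMr// mulrDr; nra.
have := phi_concave _ _ l By Bx l01; rewrite -/z dotvZr ler_norml => cz /andP[_].
set D := dotv _ _ => Hz.
have lN : e / (N + 1) * (l * N) <= l * e.
  by rewrite mulrCA ler_pM2l// mulrAC ler_pdivrMr// ler_pM2l//; lra.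
rewrite -(ler_pM2l l0); lra.
Qed.

(** The Lipschitz bound between [b] and 0 gives [0 <= G |b|]. When [n = 0] the constant [G] itself
    may be negative. *)
Lemma lipschitz_diam_ge0 : 0 <= G * enorm b ^+ 2.
Proof.
have := grad_lip _ _ rateboxb ratebox0; rewrite subr0.
move=> /(le_trans (enorm_ge0 _)); rewrite expr2 mulrA => ?.
by rewrite mulr_ge0// enorm_ge0.
Qed.

(* Descent lemma. Along the subdivision [x + (k/N)(y - x)], concavity bounds each
   increment below by the gradient at its right end; then let N tend to infinity. *)
Lemma smooth_lower_bound x y : B x -> B y ->
  phi x + dotv (grad x) (y - x) - G / 2 * enorm (y - x) ^+ 2 <= phi y.
Proof.
move=> Bx By; set v := y - x; set D := dotv _ _.
pose pt (N k : nat) := (k%:R / N%:R) *: y + (1 - k%:R / N%:R) *: x.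
have ptB N k : (k <= N)%N -> B (pt N k).
  move=> kN; apply: ratebox_conv => //; rewrite divr_ge0//=.
  case: N kN => [|N] kN; first by rewrite invr0 mulr0.
  by rewrite ler_pdivrMr ?ltr0n// mul1r ler_nat.
have ptE N k l : pt N k - pt N l = ((k%:R - l%:R) / N%:R) *: v.
  by apply/rowP => i; rewrite !mxE; ring.
have pt0 N : pt N 0 = x by rewrite /pt mul0r scale0r add0r subr0 scale1r.
have step N k : (k < N)%N ->
    D / N%:R - G * enorm v ^+ 2 * (k%:R + 1) / N%:R ^+ 2 <= phi (pt N k.+1) - phi (pt N k).
  move=> kN; have N0 : 0 < N%:R :> R by rewrite ltr0n (leq_ltn_trans _ kN).
  have := concave_gradient _ _ (ptB _ _ kN) (ptB _ _ (ltnW kN)).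
  have := grad_lip _ _ (ptB _ _ kN) Bx.
  have -> : pt N k - pt N k.+1 = (- N%:R^-1) *: v.
    by rewrite ptE -natr1; congr (_ *: _); ring.
  have -> : pt N k.+1 - x = (k.+1%:R / N%:R) *: v by rewrite -[in LHS](pt0 N) ptE subr0.
  rewrite dotvZr enormZ ger0_norm ?divr_ge0//.
  have := normr_dotv_le (grad (pt N k.+1) - grad x) v.
  rewrite dotvBl -/D ler_norml => /andP[+ _].
  set E := dotv (grad (pt N k.+1)) v; set g := enorm (grad _ - _); set w := enorm v.
  move=> H1 H2 H3.
  have w0 : 0 <= w := enorm_ge0 _.
  have H4 : g * w <= G * w ^+ 2 * (k%:R + 1) / N%:R.
    have := ler_wpM2r w0 H2.
    suff -> : G * (k.+1%:R / N%:R * w) * w = G * w ^+ 2 * (k%:R + 1) / N%:R by [].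
    by rewrite -natr1; ring.
  have H5 : D - G * w ^+ 2 * (k%:R + 1) / N%:R <= E by lra.
  have H6 : (D - G * w ^+ 2 * (k%:R + 1) / N%:R) / N%:R <= E / N%:R.
    by rewrite ler_pM2r ?invr_gt0.
  move: H3 H6; rewrite mulrBl expr2 invfM !mulrA [E / _]mulrC mulNr; lra.
(* Sum of the first [k] increments, with [1 + ... + k = k (k + 1) / 2]. *)
have H N k : (k <= N)%N -> phi x + k%:R * (D / N%:R)
    - G * enorm v ^+ 2 * (k%:R * (k%:R + 1) / 2) / N%:R ^+ 2 <= phi (pt N k).
  elim: k => [_|k IH kN].
    by rewrite pt0 !mul0r mulr0 mul0r subr0 addr0.
  have := IH (ltnW kN); have := step _ _ kN; rewrite -[k.+1%:R]natr1.
  move: (N%:R ^+ 2)^-1 (D / _) => c c'; lra.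
apply/ler_addgt0Pr.
change (forall e : R, 0 < e -> phi x + D - G / 2 * enorm v ^+ 2 <= phi y + e) => e e0.
set K := G * enorm v ^+ 2 in H *.
(* At [k = N.+1] the quadratic error is [K / 2 + K / 2 / N.+1]; this [N] makes the excess over
   [K / 2] smaller than [e]. *)
have [N HN] : exists N : nat, K / 2 / e < N.+1%:R.
  by exists (Num.truncn (K / 2 / e)); exact: truncnS_gt.
have := H N.+1 N.+1 (leqnn _).
have -> : pt N.+1 N.+1 = y by rewrite /pt divff ?pnatr_eq0// subrr scale0r addr0 scale1r.
move: HN; rewrite ltr_pdivrMr// => HN.
have N0 : N.+1%:R != 0 :> R by rewrite pnatr_eq0.
have -> : K * (N.+1%:R * (N.+1%:R + 1) / 2) / N.+1%:R ^+ 2 = K / 2 + K / 2 / N.+1%:R.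
  by field.
have -> : N.+1%:R * (D / N.+1%:R) = D by field.
have : K / 2 / N.+1%:R < e by rewrite ltr_pdivrMr ?ltr0n// [ltRHS]mulrC.
have -> : G / 2 * enorm v ^+ 2 = K / 2 by rewrite /K mulrAC.
by move: (K / 2) (K / 2 / _) => c c'; lra.
Qed.

(** Jensen's inequality by induction: the mean of [N.+2] points is a convex combination of the mean
    of the first [N.+1], with weight [N.+1 / N.+2], and the last point. *)
Lemma concave_mean (g : nat -> 'rV[R]_n) N : (forall t, B (g t)) -> (0 < N)%N ->
  N%:R^-1 * (\sum_(t < N) phi (g t)) <= phi (N%:R^-1 *: \sum_(t < N) g t).
Proof.
move=> gB; case: N => // N _; elim: N => [|N IH].
  by rewrite !big_ord1 invr1 scale1r mul1r.
set l : R := N.+1%:R / N.+2%:R.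
have N1 : N.+1%:R != 0 :> R by rewrite pnatr_eq0.
have N2 : N.+2%:R != 0 :> R by rewrite pnatr_eq0.
have l01 : 0 <= l <= 1.
  by rewrite divr_ge0//= ler_pdivrMr ?ltr0n// mul1r ler_nat.
have l1 : 1 - l = N.+2%:R^-1.
  by rewrite -[X in X - _](divff N2) -mulrBl -natrB// subSnn mul1r.
have lN : l * N.+1%:R^-1 = N.+2%:R^-1 by rewrite /l mulrAC divff// mul1r.
have -> : N.+2%:R^-1 *: \sum_(t < N.+2) g t
    = l *: (N.+1%:R^-1 *: \sum_(t < N.+1) g t) + (1 - l) *: g N.+1.
  by rewrite big_ord_recr/= scalerDr scalerA lN l1.
apply: le_trans (phi_concave _ _ l (ratebox_mean _ N.+1 gB _) (gB _) l01) => //.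
rewrite big_ord_recr/= mulrDr -{1}lN -l1 -mulrA lerD2r ler_wpM2l//.
by case/andP: l01.
Qed.

(** * Comparison of the running average with the averaged iterates *)

Section Averaging.
Context {d : measure_display} {Omega : measurableType d}.
Variables (mu : nat -> Omega -> 'rV[R]_n) (eta : R).
Hypothesis muB : forall t w, B (mu t w).
Hypothesis eta01 : 0 < eta < 1.

Lemma gprev_ratebox t w : B (gprev eta mu t w).
Proof.
elim: t => [|t IH] /=; first exact: ratebox0.
have := ratebox_conv (1 - eta) _ _ _ IH (muB t w).
by rewrite subKr; apply; case/andP: eta01 => ? ?; apply/andP; split; lra.
Qed.

(** Telescoped form of [gam_(t+1) - gam_t = eta (mu_t - gam_t)], where [gam_t] is [gprev] at [t] and
    starts from 0. *)
Lemma gprev_sum N w : eta *: \sum_(t < N) mu t w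
  = gprev eta mu N w + eta *: \sum_(t < N) gprev eta mu t w.
Proof.
elim: N => [|N IH]; first by rewrite !big_ord0 /= add0r.
rewrite !big_ord_recr/= !scalerDr IH.
by apply/rowP => i; rewrite !mxE; ring.
Qed.

Lemma mubar_utility_ge N w : (0 < N)%N ->
  N%:R^-1 * (\sum_(t < N) phi (gprev eta mu t w)) <= phi (mubar mu N w).
Proof.
move=> N0; apply: le_trans (concave_mean (fun t => gprev eta mu t w) N (gprev_ratebox^~ w) N0) _.
apply: phi_nondecr => [||i].
- exact: (ratebox_mean (gprev eta mu ^~ w) N (gprev_ratebox^~ w) N0).
- exact: (ratebox_mean (mu^~ w) N (muB^~ w) N0).
rewrite !mxE ler_pM2l ?invr_gt0 ?ltr0n//.
have eta0 : 0 < eta by case/andP: eta01.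
(* By [gprev_sum], [eta] times the gap between the two sums is [gprev] at [N], which is entrywise
   nonnegative. *)
have /(_ i)/andP[g0 _] := gprev_ratebox N w.
have /rowP/(_ i) := gprev_sum N w; move: (gprev _ _ N w) g0 => g g0.
by rewrite !mxE -(ler_pM2l eta0) => ->; rewrite lerDr.
Qed.

End Averaging.
End Box.
End Euclidean.

(** * Measurability of continuous functions of a box-valued process *)

(* The rounding [x |-> truncn (k x) / k] has countable range and stays in the box, so
   [h] composed with the rounded process is measurable; then let k tend to infinity. *)
Lemma measurable_econtinuous_comp {R : realType} {n : nat} (b : 'rV[R]_n)
    {d : measure_display} {Omega : measurableType d} (Y : Omega -> 'rV[R]_n)
    (h : 'rV[R]_n -> R) :
  (forall w, ratebox b (Y w)) ->
  (forall i, measurable_fun setT (fun w => Y w ord0 i)) ->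
  econtinuous_in (ratebox b) h -> measurable_fun setT (fun w => h (Y w)).
Proof.
move=> YB mY hc.
pose c (k : nat) (w : Omega) : {ffun 'I_n -> nat} :=
  [ffun i => Num.truncn (k.+1%:R * Y w ord0 i)].
pose q (k : nat) (z : {ffun 'I_n -> nat}) : 'rV[R]_n :=
  \row_i ((z i)%:R / k.+1%:R).
have Y0 w i : 0 <= Y w ord0 i by have /andP[] := YB w i.
have kY0 k w i : 0 <= k.+1%:R * Y w ord0 i by rewrite mulr_ge0.
have qY k w i : 0 <= Y w ord0 i - q k (c k w) ord0 i <= k.+1%:R^-1.
  have k0 : 0 < k.+1%:R :> R by rewrite ltr0n.
  rewrite /q mxE /c ffunE; have /andP[le1 lt1] := truncn_itv (kY0 k w i).
  rewrite subr_ge0 ler_pdivrMr// [leRHS]mulrC le1/=.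
  rewrite lerBlDr -[X in _ <= X + _]mul1r -mulrDl ler_pdivlMr// mulrC.
  by rewrite addrC natr1 ltW.
(* Rounding down stays in the box, the only place where [h] is known to be continuous. *)
have qB k w : ratebox b (q k (c k w)).
  move=> i; have /andP[Y0i Yb] := YB w i; have /andP[q0 _] := qY k w i.
  apply/andP; split; last by apply: le_trans Yb; rewrite -subr_ge0.
  by rewrite /q mxE divr_ge0.
apply: (@measurable_fun_cvg _ _ _ _ (fun k w => h (q k (c k w)))).
  move=> k _ A mA; rewrite setTI.
  have -> : (fun w => h (q k (c k w))) @^-1` A =
      \bigcup_(z : {ffun 'I_n -> nat}) ((c k @^-1` [set z]) `&` [set _ | A (h (q k z))]).
    apply/seteqP; split=> [w Aw|w [z _ [<-]]] //.
    by exists (c k w).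
  apply: countable_bigcupT_measurable => [|z]; first exact: countableP.
  apply: measurableI; last first.
    have [Az|Az] := pselect (A (h (q k z))).
      by rewrite (_ : [set _ | _] = setT)// -subTset.
    by rewrite (_ : [set _ | _] = set0)// -subset0.
  (* A fixed code [z] confines each coordinate to a half-open interval, so its preimage is a finite
     intersection of measurable sets. *)
  have -> : c k @^-1` [set z] = \bigcap_(i in [set: 'I_n])
      ((fun w => Y w ord0 i) @^-1` `[(z i)%:R / k.+1%:R, (z i).+1%:R / k.+1%:R[%classic).
    apply/seteqP; split=> [w /= <- i _ /=|w /= wz].
      rewrite in_itv/= ffunE ler_pdivrMr ?ltr0n// ltr_pdivlMr ?ltr0n// mulrC.
      by apply: truncn_itv; rewrite mulr_ge0.
    apply/ffunP => i; rewrite ffunE; apply/truncn_def.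
    have := wz i I; rewrite /= in_itv/= ler_pdivrMr ?ltr0n// ltr_pdivlMr ?ltr0n//.
    by rewrite mulrC.
  apply: fin_bigcap_measurable => // i _.
  by rewrite -[X in measurable X]setTI; exact: mY.
move=> w _; apply/cvgrPdist_lt => e e0.
have [dl dl0 dlP] := hc _ (YB w) _ e0.
(* The rounding error has norm at most [n / k.+1]; dividing [dl] by [n + 1] also covers [n = 0]. *)
have n1 : 0 < n%:R + 1 :> R by rewrite ltr_wpDl.
have /cvgrPdist_lt/(_ _ (divr_gt0 dl0 n1)) := @cvg_harmonic R.
apply: filterS => k; rewrite sub0r normrN ger0_norm ?harmonic_ge0//= ltr_pdivlMr// => kdl.
rewrite distrC; apply: dlP => //; apply: le_lt_trans kdl.
apply: (@le_trans _ _ (n%:R * k.+1%:R^-1)).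
  rewrite enorm_distC; apply: enorm_le_coord => // i.
  have -> : (Y w - q k (c k w)) ord0 i = Y w ord0 i - q k (c k w) ord0 i by rewrite !mxE.
  by have /andP[? ?] := qY k w i; rewrite ger0_norm.
by rewrite mulrC ler_pM2l// lerDl.
Qed.

(** * Expectations of bounded random variables *)

Section Expectation.
Context {R : realType} {d : measure_display} {Omega : measurableType d}.
Variable P : probability Omega R.

Lemma bounded_integrable (f : Omega -> R) (K : R) :
  measurable_fun setT f -> (forall w, `|f w| <= K) -> P.-integrable setT (EFin \o f).
Proof.
move=> mf fK; apply: measurable_bounded_integrable => //.
  exact: le_lt_trans (probability_le1 P measurableT) (ltry 1).
exists K; split; first exact: num_real.
by move=> M KM w _; exact: le_trans (fK w) (ltW KM).
Qed.

Lemma Rintegral_cst_prob (k : R) : \int[P]_w k = k.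
Proof. by rewrite Rintegral_cst//= (@probability_setT _ _ _ P) mulr1. Qed.

Lemma le_Rintegral_cst (f : Omega -> R) (k : R) :
  P.-integrable setT (EFin \o f) -> (forall w, k <= f w) -> k <= \int[P]_w f w.
Proof.
move=> If kf; rewrite -[leLHS]Rintegral_cst_prob; apply: le_Rintegral => //.
by apply: (@bounded_integrable _ `|k|).
Qed.

Lemma integrable_sumr (I : Type) (s : seq I) (f : I -> Omega -> R) :
  (forall i, P.-integrable setT (EFin \o f i)) ->
  P.-integrable setT (EFin \o (fun w => \sum_(i <- s) f i w)).
Proof.
move=> If; have := @integrable_sum _ _ _ P setT measurableT _ s xpredT (fun i => EFin \o f i).
by move=> /(_ (fun i _ => If i)); apply: eq_integrable => // w _; rewrite /= -sumEFin.
Qed.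

Lemma Rintegral_sum (I : Type) (s : seq I) (f : I -> Omega -> R) :
  (forall i, P.-integrable setT (EFin \o f i)) ->
  \int[P]_w (\sum_(i <- s) f i w) = \sum_(i <- s) \int[P]_w f i w.
Proof.
move=> If; elim: s => [|i s IH].
  under eq_Rintegral do rewrite big_nil.
  by rewrite Rintegral_cst_prob big_nil.
under eq_Rintegral do rewrite big_cons.
by rewrite RintegralD// ?IH ?big_cons//; exact: integrable_sumr.
Qed.

(* Fubini for the law of (X, Y), which independence makes a product measure. *)
Lemma Rintegral_indep_mul (X Y : Omega -> R) (K : R) :
  measurable_fun setT X -> measurable_fun setT Y ->
  (forall w, `|X w| <= K) -> (forall w, `|Y w| <= K) ->
  (forall A B : set R, measurable A -> measurable B ->
     P (X @^-1` A `&` Y @^-1` B) = (P (X @^-1` A) * P (Y @^-1` B))%E) ->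
  \int[P]_w (X w * Y w) = \int[P]_w X w * \int[P]_w Y w.
Proof.
move=> mX mY XK YK XY.
pose XX : {mfun Omega >-> R} := mfun_Sub (mem_set mX).
pose YY : {mfun Omega >-> R} := mfun_Sub (mem_set mY).
have mXY : measurable_fun setT (fun w => (X w, Y w)) by exact: measurable_fun_pair.
pose Z : {mfun Omega >-> (R * R)%type} := mfun_Sub (mem_set mXY).
pose f (z : R * R) := (z.1 * z.2)%:E.
have mf : measurable_fun setT f.
  by apply/measurable_EFinP; apply: measurable_funM; [exact: measurable_fst|exact: measurable_snd].
have IX : P.-integrable setT (EFin \o X) by exact: bounded_integrable XK.
have IY : P.-integrable setT (EFin \o Y) by exact: bounded_integrable YK.
have IXY : P.-integrable setT (f \o Z).
  apply: (@bounded_integrable (fun w => X w * Y w) (K * K)).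
    exact: measurable_funM.
  by move=> w; rewrite normrM ler_pM.
(* Independence gives agreement on measurable rectangles, and these determine the product
   measure. *)
have prodE A : measurable A ->
    (distribution P XX \x distribution P YY)%E A = distribution P Z A.
  by apply: product_measure_unique => A1 A2 mA1 mA2; exact: XY.
have If : (distribution P XX \x distribution P YY)%E.-integrable setT f.
  have /integrableP[_ fin] : (distribution P Z).-integrable setT f.
    exact: integrable_pushforward.
  apply/integrableP; split => //; apply: le_lt_trans fin.
  by rewrite (eq_measure_integral (distribution P Z))// => A mA _; exact: prodE.
have id_int (V : {mfun Omega >-> R}) : P.-integrable setT (EFin \o V) ->
    (\int[distribution P V]_x x%:E = \int[P]_w (V w)%:E)%E.
  by move=> IV; rewrite integral_distribution.
have id_intble (V : {mfun Omega >-> R}) : P.-integrable setT (EFin \o V) ->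
    (distribution P V).-integrable setT EFin.
  by move=> IV; exact: integrable_pushforward.
rewrite /Rintegral.
have -> : (\int[P]_w (X w * Y w)%:E = \int[distribution P Z]_z f z)%E.
  by rewrite integral_distribution.
rewrite (eq_measure_integral (distribution P XX \x distribution P YY)%E); last first.
  by move=> A mA _; exact/esym/prodE.
rewrite -integral12_prod_meas1//.
(* The inner integral of the Fubini formula is [x E[Y]], which is linear in [x]. *)
have F x : fubini_F (distribution P YY) f x = (x%:E * (\int[P]_w (Y w)%:E))%E.
  rewrite /fubini_F /f /=.
  under eq_integral do rewrite EFinM.
  by rewrite integralZl ?id_intble// id_int.
rewrite (eq_integral (fun x : R => (x%:E * \int[P]_w (Y w)%:E)%E)); last by move=> x _; exact: F.
rewrite -(fineK (integrable_fin_num _ IY))//.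
rewrite integralZr ?id_intble// id_int// fineM//.
exact: integrable_fin_num.
Qed.

End Expectation.

(** * Measurability of the averages, and a geometric sum *)

(** Only slots before [t] have to be measurable, so the lemma also applies to the sigma-algebra of
    the past. *)
Lemma measurable_gprev {R : realType} {n : nat} {d : measure_display}
    {Omega : measurableType d} (mu : nat -> Omega -> 'rV[R]_n) (eta : R) t :
  (forall k i, (k < t)%N -> measurable_fun setT (fun w => mu k w ord0 i)) ->
  forall i, measurable_fun setT (fun w => gprev eta mu t w ord0 i).
Proof.
elim: t => [|t IH] mmu i.
  by apply: (eq_measurable_fun (cst (0 : R))) => // w _; rewrite mxE.
apply: (eq_measurable_fun
    (fun w => (1 - eta) * gprev eta mu t w ord0 i + eta * mu t w ord0 i)).
  by move=> w _; rewrite /= !mxE.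
apply: measurable_funD; apply: measurable_funM => //; last exact: mmu.
by apply: IH => k j kt; apply: mmu; exact: ltnW.
Qed.

Lemma measurable_mubar {R : realType} {n : nat} {d : measure_display}
    {Omega : measurableType d} (mu : nat -> Omega -> 'rV[R]_n) N :
  (forall k i, measurable_fun setT (fun w => mu k w ord0 i)) ->
  forall i, measurable_fun setT (fun w => mubar mu N w ord0 i).
Proof.
move=> mmu i.
apply: (eq_measurable_fun (fun w => N%:R^-1 * \sum_(t < N) mu t w ord0 i)).
  by move=> w _; rewrite /mubar mxE summxE.
by apply: measurable_funM => //; apply: measurable_sum => t; exact: mmu.
Qed.

Lemma sum_geometric_le {R : realType} (eta : R) N : 0 < eta < 1 ->
  \sum_(t < N) (1 - eta) ^+ t <= eta^-1.
Proof.
move=> /andP[e0 e1].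
have e : eta * (\sum_(t < N) (1 - eta) ^+ t) = 1 - (1 - eta) ^+ N.
  elim: N => [|N IH]; first by rewrite big_ord0 mulr0 expr0 subrr.
  by rewrite big_ord_recr/= mulrDr IH exprS; ring.
rewrite -(ler_pM2l e0) divff ?gt_eqF// e gerBl exprn_ge0//; lra.
Qed.

(** * Uniform bounds and integrability along the EXP algorithm *)

Section EXP.
Context {R : realType} {n : nat} {d : measure_display} {Omega : measurableType d}.
Variable P : probability Omega R.
Context {dT : measure_display} {T : measurableType dT}.
Variables (S : nat -> Omega -> T) (Gam : T -> set 'rV[R]_n) (b : 'rV[R]_n).
Variables (phi : 'rV[R]_n -> R) (grad : 'rV[R]_n -> 'rV[R]_n) (G : R).
Variables (eta : R) (mu : nat -> Omega -> 'rV[R]_n).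
Local Notation B := (ratebox b).
Local Notation gam := (gprev eta mu).
Hypothesis b_gt0 : forall i, 0 < b ord0 i.
Hypothesis GamB : forall s, Gam s `<=` B.
Hypothesis iidS : iid_states P S.
Hypothesis phi_concave : concave_in B phi.
Hypothesis phi_nondecr : nondecr_in B phi.
Hypothesis phi_grad : gradient_in B phi grad.
Hypothesis grad_lip : lipschitz_in B grad G.
Hypothesis eta01 : 0 < eta < 1.
Hypothesis mu_adm : admissible_policy P S Gam mu.
Hypothesis mu_EXP : EXP_decisions eta grad S Gam mu.

Let mmu k i : measurable_fun setT (fun w => mu k w ord0 i).
Proof. by case: mu_adm. Qed.

Let muB t w : B (mu t w).
Proof. by case: mu_adm => _ muG _; exact: GamB (muG t w). Qed.

Let gamB t w : B (gam t w). Proof. exact: gprev_ratebox. Qed.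

Let mgam t i : measurable_fun setT (fun w => gam t w ord0 i).
Proof. exact: measurable_gprev. Qed.

(** A single constant that bounds, on the box, the coordinates of [grad], the values of [phi] and
    the coordinates of the points. *)
Let K := enorm (grad 0) + `|G| * enorm b + enorm b + `|phi 0| + `|phi b|.

Let grad_bounded x i : B x -> `|grad x ord0 i| <= K.
Proof.
move=> Bx; have B0 := ratebox0 _ b_gt0.
have := normr_coord_le_enorm (grad x - grad 0) i.
have := normr_coord_le_enorm (grad 0) i.
have := ler_normD (grad x ord0 i - grad 0 ord0 i) (grad 0 ord0 i); rewrite subrK !mxE.
have := grad_lip _ _ Bx B0.
have : G * enorm (x - 0) <= `|G| * enorm b.
  apply: le_trans (ler_wpM2r (enorm_ge0 _) (ler_norm G)) _.
  by apply: ler_wpM2l => //; exact: ratebox_diam.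
have := enorm_ge0 b; have := normr_ge0 (phi 0); have := normr_ge0 (phi b).
rewrite /K; lra.
Qed.

Let phi_bounded x : B x -> `|phi x| <= K.
Proof.
move=> Bx.
have l : phi 0 <= phi x.
  by apply: phi_nondecr => //; [exact: ratebox0|move=> i; rewrite mxE; case/andP: (Bx i)].
have u : phi x <= phi b.
  by apply: phi_nondecr => //; [exact: rateboxb|move=> i; case/andP: (Bx i)].
have := ler_norm (phi b); have := ler_norm (- phi 0); rewrite normrN.
have := enorm_ge0 b; have := enorm_ge0 (grad 0); have := normr_ge0 (phi 0); have := normr_ge0 (phi b).
have : 0 <= `|G| * enorm b by rewrite mulr_ge0 ?enorm_ge0.
by rewrite ler_norml /K => *; apply/andP; split; lra.
Qed.

Let box_bounded x i : B x -> `|x ord0 i| <= K.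
Proof.
move=> Bx; apply: le_trans (normr_coord_le_enorm _ _) _.
have := ratebox_diam _ _ _ Bx (ratebox0 _ b_gt0); rewrite subr0.
have := enorm_ge0 (grad 0); have := normr_ge0 (phi 0); have := normr_ge0 (phi b).
have : 0 <= `|G| * enorm b by rewrite mulr_ge0 ?enorm_ge0.
by rewrite /K; lra.
Qed.

Let integrable_phi (Y : Omega -> 'rV[R]_n) : (forall w, B (Y w)) ->
  (forall i, measurable_fun setT (fun w => Y w ord0 i)) ->
  P.-integrable setT (EFin \o (fun w => phi (Y w))).
Proof.
move=> YB mY; apply: (bounded_integrable _ _ K); last by move=> w; exact: phi_bounded.
exact: measurable_econtinuous_comp YB mY (econtinuous_gradient _ _ _ phi_grad).
Qed.

Let integrable_grad t i : P.-integrable setT (EFin \o (fun w => grad (gam t w) ord0 i)).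
Proof.
apply: (bounded_integrable _ _ K); last by move=> w; exact: grad_bounded.
exact: measurable_econtinuous_comp (gamB t) (mgam t) (econtinuous_lipschitz_coord _ _ _ grad_lip i).
Qed.

Let integrable_grad_mul t i (y : Omega -> R) : measurable_fun setT y ->
  (forall w, `|y w| <= K) ->
  P.-integrable setT (EFin \o (fun w => grad (gam t w) ord0 i * y w)).
Proof.
move=> my yK; apply: (bounded_integrable _ _ (K * K)).
  apply: measurable_funM => //.
  exact: measurable_econtinuous_comp (gamB t) (mgam t) (econtinuous_lipschitz_coord _ _ _ grad_lip i).
by move=> w; rewrite normrM ler_pM// grad_bounded.
Qed.

Let integrable_dotv_grad t (Y : Omega -> 'rV[R]_n) :
  (forall i, measurable_fun setT (fun w => Y w ord0 i)) -> (forall w, B (Y w)) ->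
  P.-integrable setT (EFin \o (fun w => dotv (grad (gam t w)) (Y w))).
Proof.
move=> mY YB; apply: integrable_sumr => i.
by apply: integrable_grad_mul => // w; exact: box_bounded.
Qed.

(** * Independence and stationarity of the channel states *)

(** [gam t] is built from decisions strictly before slot [t], and these are independent of [S t] by
    causality. *)
Lemma indep_gprev_state t (h : 'rV[R]_n -> R) (f : T -> R) (A1 A2 : set R) :
  econtinuous_in B h -> measurable_fun setT f -> measurable A1 -> measurable A2 ->
  P ((fun w => h (gam t w)) @^-1` A1 `&` (f \o S t) @^-1` A2)
  = (P ((fun w => h (gam t w)) @^-1` A1) * P ((f \o S t) @^-1` A2))%E.
Proof.
(* At slot 0 the iterate is constant and its events are trivial; at slot [t.+1] causality is used at
   [t]. *)
move=> hc mf mA1 mA2; case: t => [|t].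
  have [h0|h0] := pselect (A1 (h 0)).
    rewrite (_ : _ @^-1` A1 = setT); last by rewrite -subTset.
    by rewrite setTI probability_setT mul1e.
  rewrite (_ : _ @^-1` A1 = set0); last by rewrite -subset0.
  by rewrite set0I measure0 mul0e.
case: mu_adm => _ _ /(_ t); apply.
  (* The measurability lemmas are rerun on [Omega] with the sigma-algebra generated by the past up
     to [t]. *)
  have : measurable_fun setT ((fun w => h (gam t.+1 w)) : g_sigma_algebraType (past_events S mu t) -> R).
    apply: (@measurable_econtinuous_comp _ _ b _ (g_sigma_algebraType (past_events S mu t)) (gam t.+1)) => //.
    apply: (@measurable_gprev _ _ _ (g_sigma_algebraType (past_events S mu t)) mu eta t.+1).
    move=> k i kt _ A mA; rewrite setTI; apply: sub_sigma_algebra.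
    by exists k => //; right; exists i, A.
  by move=> /(_ measurableT _ mA1); rewrite setTI.
apply: sub_sigma_algebra; exists t.+1 => //; exists (f @^-1` A2) => //.
by rewrite -[X in measurable X]setTI; exact: mf.
Qed.

Lemma Rintegral_state t (f : T -> R) : measurable_fun setT f ->
  (forall s, `|f s| <= K) -> \int[P]_w f (S t w) = \int[P]_w f (S 0 w).
Proof.
move=> mf fK; case: iidS => mS eqS _.
have E k : (\int[distribution P (mfun_Sub (mem_set (mS k)))]_s (f s)%:E
    = \int[P]_w (f (S k w))%:E)%E.
  rewrite integral_distribution//; first exact/measurable_EFinP.
  apply: (bounded_integrable P (fun w => f (S k w)) K); last by [].
  exact: (measurableT_comp mf (mS k)).
rewrite /Rintegral -!E; congr fine.
by apply: eq_measure_integral => A mA _; exact: eqS.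
Qed.

(** * Comparison with a randomized rule that sees only the current state *)

Section Comparison.
Context {dU : measure_display} {U : measurableType dU}.
Variables (Q : probability U R) (f : T -> U -> 'rV[R]_n) (x : 'rV[R]_n).
Hypothesis mf : forall i, measurable_fun setT (fun p : T * U => f p.1 p.2 ord0 i).
Hypothesis fG : forall s u, Gam s (f s u).
Hypothesis fx : forall i, (\int[(P \x Q)%E]_p (f (S 0 p.1) p.2 ord0 i)%:E)%E = (x ord0 i)%:E.

(** Conditional mean of the rule given the state [s], with the randomization integrated out. *)
Let F s : 'rV[R]_n := \row_i \int[Q]_u f s u ord0 i.

Let fB s u : B (f s u). Proof. exact: GamB. Qed.

Let mfs s i : measurable_fun setT (fun u => f s u ord0 i).
Proof. exact: (measurableT_comp (mf i) (measurable_pair1 s)). Qed.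

Let fint s i : Q.-integrable setT (EFin \o (fun u => f s u ord0 i)).
Proof. by apply: (bounded_integrable _ _ K) => // u; exact: box_bounded. Qed.

Let FB s : B (F s).
Proof.
move=> i; rewrite mxE; apply/andP; split.
  by apply: le_Rintegral_cst => // u; case/andP: (fB s u i).
rewrite -(Rintegral_cst_prob Q (b ord0 i)); apply: le_Rintegral => //.
  by apply: (bounded_integrable _ _ `|b ord0 i|).
by move=> u _; case/andP: (fB s u i).
Qed.

Let mF i : measurable_fun setT (fun s => F s ord0 i).
Proof.
have : measurable_fun setT (fubini_F Q (fun p : T * U => (f p.1 p.2 ord0 i)%:E)).
  apply: measurable_fun_fubini_tonelli_F.
    exact/measurable_EFinP.
  by move=> p; rewrite lee_fin; case/andP: (fB p.1 p.2 i).
move=> /(measurableT_comp (fine_measurable measurableT)).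
by apply: eq_measurable_fun => s _; rewrite /= mxE.
Qed.

(** Tonelli's theorem, applicable because the coordinates of [f] are nonnegative. *)
Let F_mean i : \int[P]_w F (S 0 w) ord0 i = x ord0 i.
Proof.
case: iidS => mS _ _.
rewrite /Rintegral; rewrite -[RHS]/(fine (x ord0 i)%:E) -fx; congr fine.
rewrite fubini_tonelli1//; first last.
- by move=> p; rewrite lee_fin; case/andP: (fB (S 0 p.1) p.2 i).
- apply/measurable_EFinP; apply: (measurableT_comp (mf i) (g := fun p : Omega * U => (S 0 p.1, p.2))).
  apply: measurable_fun_pair => //; apply: measurableT_comp => //.
apply: eq_integral => w _; rewrite mxE /fubini_F /= /Rintegral fineK//.
exact: integrable_fin_num (fint _ _).
Qed.

Lemma mean_ratebox : B x.
Proof.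
case: iidS => mS _ _ i; rewrite -F_mean.
have IF : P.-integrable setT (EFin \o (fun w => F (S 0 w) ord0 i)).
  apply: (bounded_integrable _ _ K); first exact: measurableT_comp (mF i) (mS 0%N).
  by move=> w; exact: box_bounded.
apply/andP; split.
  by apply: le_Rintegral_cst => // w; case/andP: (FB (S 0 w) i).
rewrite -(Rintegral_cst_prob P (b ord0 i)); apply: le_Rintegral => //.
  by apply: (bounded_integrable _ _ `|b ord0 i|).
by move=> w _; case/andP: (FB (S 0 w) i).
Qed.

(* [mu t w] beats every [f (S t w) u], hence their average over [u]; the latter only
   depends on [S t], which is independent of the past gradient. *)
Lemma EXP_comparison t :
  \int[P]_w dotv (grad (gam t w)) x <= \int[P]_w dotv (grad (gam t w)) (mu t w).
Proof.
case: iidS => mS _ _.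
have mFS i k : measurable_fun setT (fun w => F (S k w) ord0 i).
  exact: measurableT_comp (mF i) (mS k).
have IF i := integrable_grad_mul t i _ (mFS i t) (fun w => box_bounded _ i (FB _)).
(* Coordinatewise, independence splits [E[grad_i F_i(S t)]] into a product, and [F_i(S t)] has the
   mean [x_i] of [F_i(S 0)]. *)
have -> : \int[P]_w dotv (grad (gam t w)) x = \int[P]_w dotv (grad (gam t w)) (F (S t w)).
  rewrite /dotv !Rintegral_sum//.
    apply: eq_bigr => i _; rewrite RintegralZr//.
    rewrite (Rintegral_indep_mul P _ _ K) ?F_mean//.
    - by rewrite (Rintegral_state _ (fun s => F s ord0 i)) ?F_mean// => s; exact: box_bounded.
    - exact: measurable_econtinuous_comp (gamB t) (mgam t) (econtinuous_lipschitz_coord _ _ _ grad_lip i).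
    - by move=> w; exact: grad_bounded.
    - by move=> w; exact: box_bounded.
    - move=> A1 A2 mA1 mA2.
      exact: (indep_gprev_state t _ (fun s => F s ord0 i) _ _ (econtinuous_lipschitz_coord _ _ _ grad_lip i)).
  by move=> i; apply: integrable_grad_mul => // w; exact: box_bounded (mean_ratebox).
apply: le_Rintegral => //.
- by apply: integrable_dotv_grad => // i; exact: mFS.
- exact: integrable_dotv_grad.
move=> w _; set g := grad _.
have Ig i : Q.-integrable setT (EFin \o (fun u => g ord0 i * f (S t w) u ord0 i)).
  apply: (bounded_integrable _ _ (`|g ord0 i| * K)); first exact: measurable_funM.
  by move=> u; rewrite normrM ler_wpM2l// box_bounded.
have -> : dotv g (F (S t w)) = \int[Q]_u dotv g (f (S t w) u).
  by rewrite /dotv Rintegral_sum//; apply: eq_bigr => i _; rewrite RintegralZl// mxE.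
rewrite -[leRHS](Rintegral_cst_prob Q); apply: le_Rintegral => //.
- exact: integrable_sumr.
- by apply: (bounded_integrable _ _ `|dotv g (mu t w)|).
by move=> u _; exact: mu_EXP.
Qed.

End Comparison.

(** * Recursion for the expected utility *)

Lemma Gamma_star_ratebox x : Gamma_star P (S 0) Gam x -> B x.
Proof. by move=> [dU [U [Q [f [mf fG fx]]]]]; exact: mean_ratebox mf fG fx. Qed.

Let mean_phi t := \int[P]_w phi (gam t w).
Let c := eta * G * enorm b ^+ 2 / 2.

Lemma EXP_recursion x t : Gamma_star P (S 0) Gam x ->
  (1 - eta) * mean_phi t + eta * (phi x - c) <= mean_phi t.+1.
Proof.
move=> Gx; have Bx := Gamma_star_ratebox _ Gx.
case: Gx => dU [U [Q [f [mf fG fx]]]].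
have cmp := EXP_comparison Q f x mf fG fx t.
have /andP[eta0 eta1] := eta01.
have Ix : P.-integrable setT (EFin \o (fun w => dotv (grad (gam t w)) x)).
  exact: (integrable_dotv_grad t (fun=> x)).
have Im : P.-integrable setT (EFin \o (fun w => dotv (grad (gam t w)) (mu t w))).
  exact: integrable_dotv_grad.
have Ip s : P.-integrable setT (EFin \o (fun w => phi (gam s w))).
  exact: integrable_phi.
pose D w := dotv (grad (gam t w)) (mu t w) - dotv (grad (gam t w)) x.
have ID : P.-integrable setT (EFin \o D) by exact: (integrableB measurableT Im Ix).
(* The descent lemma is applied to the step [eta (mu - gam)]. Splitting [mu - gam] at [x] leaves
   [D], and concavity bounds [grad.(x - gam)] below by [phi x - phi gam]. *)
have pw w : (1 - eta) * phi (gam t w) + eta * D w + eta * (phi x - c) <= phi (gam t.+1 w).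
  have := smooth_lower_bound _ _ _ _ phi_concave phi_grad grad_lip _ _ (gamB t w) (gamB t.+1 w).
  have -> : gam t.+1 w - gam t w = eta *: (mu t w - gam t w).
    by apply/rowP => i; rewrite /= !mxE; ring.
  rewrite dotvZr enormZ gtr0_norm// dotvBr.
  have := concave_gradient _ _ _ phi_concave phi_grad _ _ (gamB t w) Bx; rewrite dotvBr.
  have : G * enorm (mu t w - gam t w) ^+ 2 <= G * enorm b ^+ 2.
    have dm := ratebox_diam _ _ _ (muB t w) (gamB t w).
    have [G0|G0] := leP 0 G.
      by rewrite ler_wpM2l// ler_pXn2r ?nnegrE ?enorm_ge0.
    (* A negative [G] forces a box of diameter 0, and both sides vanish. *)
    have b0 : enorm b = 0.
      apply/eqP; rewrite -sqrf_eq0 eq_le sqr_ge0 andbT -(nmulr_rge0 _ G0).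
      exact: lipschitz_diam_ge0 grad_lip.
    move: dm; rewrite b0 => v0.
    by rewrite (_ : enorm _ = 0)//; apply/eqP; rewrite eq_le v0 enorm_ge0.
  rewrite /D /c exprMn => /(ler_wpM2l (sqr_ge0 eta)) hA /(ler_wpM2l (ltW eta0)) hB; lra.
have IpZ : P.-integrable setT (EFin \o (fun w => (1 - eta) * phi (gam t w))).
  exact: (integrableZl _ _ (Ip t)).
have IDZ : P.-integrable setT (EFin \o (fun w => eta * D w)).
  exact: (integrableZl _ _ ID).
have Ic : P.-integrable setT (EFin \o (fun w : Omega => eta * (phi x - c))).
  by apply: (bounded_integrable _ _ `|eta * (phi x - c)|).
have IS := integrableD measurableT IpZ IDZ.
apply: (@le_trans _ _ (\int[P]_w ((1 - eta) * phi (gam t w) + eta * D w + eta * (phi x - c)))).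
  rewrite RintegralD// RintegralD// Rintegral_cst_prob RintegralZl// RintegralZl//.
  have : 0 <= \int[P]_w D w by rewrite RintegralB// subr_ge0.
  by move=> ?; rewrite lerD2r lerDl mulr_ge0// ltW.
by apply: le_Rintegral => //; exact: (integrableD measurableT IS Ic).
Qed.

(** * Passage to the optimal value and the final average *)

(** Continuity of [phi] carries the bound from [Gamma_star] to its closure, which stays in the
    closed box. *)
Lemma phiopt_le v : Gamma_star P (S 0) Gam !=set0 ->
  (forall x, Gamma_star P (S 0) Gam x -> phi x <= v) -> phiopt P (S 0) Gam phi <= v.
Proof.
move=> [x0 Gx0] Gv; apply: ge_sup.
  by exists (phi x0), x0 => // e e0; exists x0 => //; rewrite subrr -(scale0r 0) enormZ normr0 mul0r.
move=> _ [x clx <-].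
have Bx : B x.
  by apply: eclosed_ratebox => e e0; have [y Gy ?] := clx _ e0; exists y => //; exact: Gamma_star_ratebox.
apply/ler_addgt0Pr => e e0.
have [dl dl0 dlP] := econtinuous_gradient _ _ _ phi_grad _ Bx _ e0.
have [y Gy xy] := clx _ dl0.
have := dlP y (Gamma_star_ratebox _ Gy); rewrite enorm_distC => /(_ xy).
rewrite ltr_norml => /andP[? ?]; have := Gv _ Gy; lra.
Qed.

Lemma phi0_le_phiopt : Gamma_star P (S 0) Gam !=set0 -> phi 0 <= phiopt P (S 0) Gam phi.
Proof.
move=> [x0 Gx0]; have Bx := Gamma_star_ratebox _ Gx0.
apply: (@le_trans _ _ (phi x0)).
  by apply: phi_nondecr => //; [exact: ratebox0|move=> i; rewrite mxE; case/andP: (Bx i)].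
apply: ub_le_sup; last first.
  by exists x0 => // e e0; exists x0 => //; rewrite subrr -(scale0r 0) enormZ normr0 mul0r.
(* Boundedness by [K] ensures that [sup] is an upper bound. *)
exists K => _ [x clx <-]; apply: le_trans (ler_norm _) (phi_bounded _ _).
by apply: eclosed_ratebox => e e0; have [y Gy ?] := clx _ e0; exists y => //; exact: Gamma_star_ratebox.
Qed.

(** Induction on [t]. The base case uses [0 <= c]; in the step, the recursion is solved for [phi x],
    so that [phiopt_le] replaces [phi x] by the supremum. *)
Lemma mean_phi_lower_bound t : Gamma_star P (S 0) Gam !=set0 ->
  phiopt P (S 0) Gam phi - c - (phiopt P (S 0) Gam phi - phi 0) * (1 - eta) ^+ t <= mean_phi t.
Proof.
move=> G0; have /andP[eta0 eta1] := eta01.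
have c0 : 0 <= c.
  rewrite /c (_ : _ / 2 = eta * (G * enorm b ^+ 2) / 2); last by ring.
  rewrite divr_ge0// mulr_ge0 ?(ltW eta0)//.
  exact: lipschitz_diam_ge0 grad_lip.
elim: t => [|t IH].
  rewrite /mean_phi /= Rintegral_cst_prob expr0 mulr1; lra.
have : phiopt P (S 0) Gam phi <= (mean_phi t.+1 - (1 - eta) * mean_phi t) / eta + c.
  apply: phiopt_le => // x Gx; rewrite -lerBlDr ler_pdivlMr//.
  have := EXP_recursion _ t Gx; lra.
rewrite -lerBlDr ler_pdivlMr// exprS; nra.
Qed.

Lemma integrable_mubar N : (0 < N)%N ->
  P.-integrable setT (EFin \o (fun w => phi (mubar mu N w))).
Proof.
move=> N0; apply: integrable_phi => [w|]; first exact: (ratebox_mean b (mu^~ w) N (muB^~ w) N0).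
exact: measurable_mubar.
Qed.

Lemma EXP_utility N : Gamma_star P (S 0) Gam !=set0 -> (0 < N)%N ->
  phiopt P (S 0) Gam phi - (phiopt P (S 0) Gam phi - phi 0) / (eta * N%:R) - c
  <= \int[P]_w phi (mubar mu N w).
Proof.
move=> G0 N0; have N0' : 0 < N%:R :> R by rewrite ltr0n.
have Ip s : P.-integrable setT (EFin \o (fun w => phi (gam s w))) by exact: integrable_phi.
apply: (@le_trans _ _ (\int[P]_w (N%:R^-1 * \sum_(t < N) phi (gam t w)))); last first.
  apply: le_Rintegral => //.
  - apply: (integrableZl _ N%:R^-1 (f := EFin \o (fun w => \sum_(t < N) phi (gam t w)))) => //.
    exact: (integrable_sumr P _ _ (fun t : 'I_N => fun w => phi (gam t w))).
  - exact: integrable_mubar.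
  - by move=> w _; exact: mubar_utility_ge.
rewrite RintegralZl//; last exact: (integrable_sumr P _ _ (fun t : 'I_N => fun w => phi (gam t w))).
rewrite (Rintegral_sum P _ _ (fun t : 'I_N => fun w => phi (gam t w)))//.
set o := phiopt _ _ _ _.
have o0 : 0 <= o - phi 0 by rewrite subr_ge0 phi0_le_phiopt.
(* Averaging the lower bounds, the geometric sum is at most [eta^-1]; as [o - phi 0] is nonnegative,
   this yields the term in [1 / (eta N)]. *)
apply: (@le_trans _ _ (N%:R^-1 * \sum_(t < N) (o - c - (o - phi 0) * (1 - eta) ^+ t))).
  rewrite sumrB sumr_const card_ord -mulr_sumr mulrBr -[(o - c) *+ N]mulr_natl mulKf ?gt_eqF//.
  have := sum_geometric_le eta N eta01; set s := \sum_(_ < _) _ => se.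
  suff : N%:R^-1 * ((o - phi 0) * s) <= (o - phi 0) / (eta * N%:R) by lra.
  rewrite (_ : _ / _ = N%:R^-1 * ((o - phi 0) * eta^-1)); last by rewrite invfM; ring.
  by rewrite ler_pM2l ?invr_gt0// ler_wpM2l.
rewrite ler_pM2l ?invr_gt0//; apply: ler_sum => t _.
exact: mean_phi_lower_bound.
Qed.

End EXP.

Theorem theorem2 (R : realType) (n : nat)
  (d : measure_display) (Omega : measurableType d) (P : probability Omega R)
  (dT : measure_display) (T : measurableType dT)
  (S : nat -> Omega -> T) (Gam : T -> set 'rV[R]_n) (mumax : 'rV[R]_n)
  (phi : 'rV[R]_n -> R) (grad : 'rV[R]_n -> 'rV[R]_n) (G : R)
  (eta : R) (mu : nat -> Omega -> 'rV[R]_n) :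
  (forall i, 0 < mumax ord0 i) ->
  (forall s, Gam s !=set0) ->
  (forall s, eclosed_set (Gam s)) ->
  (forall s, Gam s `<=` ratebox mumax) ->
  iid_states P S ->
  Gamma_star P (S 0) Gam !=set0 ->
  concave_in (ratebox mumax) phi ->
  nondecr_in (ratebox mumax) phi ->
  gradient_in (ratebox mumax) phi grad ->
  lipschitz_in (ratebox mumax) grad G ->
  0 < eta < 1 ->
  admissible_policy P S Gam mu ->
  EXP_decisions eta grad S Gam mu ->
  forall Tn : nat, (0 < Tn)%N ->
  ((phiopt P (S 0) Gam phi
     - (phiopt P (S 0) Gam phi - phi 0) / (eta * Tn%:R)
     - eta * G * enorm mumax ^+ 2 / 2)%:E
   <= \int[P]_w (phi (mubar mu Tn w))%:E)%E.
Proof.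
move=> b0 _ _ GamB iidS G0 cphi nphi gphi lip eta01 adm EXPmu N N0.
(* Integrability makes the extended-real expectation finite, which reduces the claim to real
   numbers. *)
rewrite -[leRHS]fineK ?lee_fin; last first.
  by apply: integrable_fin_num => //; exact: (integrable_mubar P S Gam mumax phi grad G mu b0 GamB nphi gphi adm).
exact: (EXP_utility P S Gam mumax phi grad).
Qed.
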